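(* Let $K:\mathbb{R}^n\to\mathbb{R}^n$ be a linear operator, let $\{f_j\}_{j=1}^n$ be a $K$-frame for $\mathbb{R}^n$, let $P:\mathbb{R}^n\to\mathbb{R}^n$ be an orthogonal projection with $KP=PK$, put $X=P(\mathbb{R}^n)$ and $Y=(I-P)(\mathbb{R}^n)$, and let $\{a_j\}_{j=1}^n,\{b_j\}_{j=1}^n$ be real constants. Then $(f_j,P,a_j,b_j)_{j=1}^n$ is a $K_s^p$-frame if and only if both of the following hold: (i) $(Pf_j,a_j)_{j=1}^n$ and $((I-P)f_j,b_j)_{j=1}^n$ are $K_s$-frames for $X$ and $Y$, respectively. (ii) For every $f\in\mathbb{R}^n$, $$\sum_{j=1}^n a_jb_j\,\langle f,Pf_j\rangle\,\langle f,(I-P)f_j\rangle=0.$$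
   Context: Let $Z$ be $\mathbb{R}^n$, $X$ or $Y$. A finite family $\{g_j\}$ in $Z$ is a $K$-frame for $Z$ if there are constants $A,B>0$ with $A\|K^*f\|^2\le\sum_j|\langle f,g_j\rangle|^2\le B\|f\|^2$ for every $f\in Z$. A $K$-frame $\{g_j\}$ for $Z$ is a $K_s$-frame for $Z$ with scaling $\{c_j\}$, denoted $(g_j,c_j)_j$, if $\{c_jg_j\}$ is a Parseval $K$-frame for $Z$, i.e. $\sum_j|\langle f,c_jg_j\rangle|^2=\|K^*f\|^2$ for every $f\in Z$. For a $K$-frame $\{f_j\}_{j=1}^n$ for $\mathbb{R}^n$, an orthogonal projection $P$ and constants $a_j,b_j$, one says that $(f_j,P,a_j,b_j)_{j=1}^n$ is a $K_s^p$-frame (piecewise scalable $K$-frame) if $\sum_{j=1}^n|\langle f,\,a_jPf_j+b_j(I-P)f_j\rangle|^2=\|K^*f\|^2$ for every $f\in\mathbb{R}^n$. *)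

(* Defs.v *)
From HB Require Import structures.
From mathcomp Require Import all_boot all_order all_algebra.
From mathcomp Require Import reals.

Set Implicit Arguments.
Unset Strict Implicit.
Unset Printing Implicit Defensive.

Import Order.TTheory GRing.Theory Num.Theory.
Local Open Scope ring_scope.

Section EuclideanSpace.
Variables (R : realType) (n : nat).
Local Notation V := 'cV[R]_n.

Definition dot (u v : V) : R := \sum_(i < n) u i 0 * v i 0.

(* Euclidean norm; the norm that MathComp-Analysis puts on matrices is the
   sup norm. *)
Definition enorm (u : V) : R := Num.sqrt (dot u u).

(* The i-th coordinate of K^* v is <e_i, K^* v> = <K e_i, v>. *)
Definition adjoint_fun (K : 'End(V)) (v : V) : V :=
  \col_i dot (K (delta_mx i 0)) v.

Definition adjoint (K : 'End(V)) : 'End(V) := linfun (adjoint_fun K).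

Definition orthogonal_projection (P : 'End(V)) : Prop :=
  (P \o P)%VF = P /\ adjoint P = P.

(* K^* is the adjoint of K on the whole of R^n, also when Z is a proper
   subspace. For Z the range of an orthogonal projection commuting with K, it
   restricts on Z to the adjoint of K : Z -> Z: see [lfun_stable_limg] and
   [adjoint_stable_limg] below. *)
Definition K_frame (K : 'End(V)) (Z : {vspace V}) (m : nat) (g : 'I_m -> V) :
    Prop :=
  (forall j, g j \in Z) /\
  exists A B : R, [/\ 0 < A, 0 < B &
    forall f : V, f \in Z ->
      A * enorm (adjoint K f) ^+ 2 <= \sum_(j < m) `|dot f (g j)| ^+ 2 /\
      \sum_(j < m) `|dot f (g j)| ^+ 2 <= B * enorm f ^+ 2].

Definition Parseval_K_frame (K : 'End(V)) (Z : {vspace V}) (m : nat)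
    (g : 'I_m -> V) : Prop :=
  (forall j, g j \in Z) /\
  forall f : V, f \in Z ->
    \sum_(j < m) `|dot f (g j)| ^+ 2 = enorm (adjoint K f) ^+ 2.

Definition Ks_frame (K : 'End(V)) (Z : {vspace V}) (m : nat) (g : 'I_m -> V)
    (c : 'I_m -> R) : Prop :=
  K_frame K Z g /\ Parseval_K_frame K Z (fun j => c j *: g j).

Definition Ksp_frame (K : 'End(V)) (m : nat) (f : 'I_m -> V) (P : 'End(V))
    (a b : 'I_m -> R) : Prop :=
  [/\ K_frame K fullv f, orthogonal_projection P &
    forall x : V,
      \sum_(j < m) `|dot x (a j *: P (f j) + b j *: (\1 - P)%VF (f j))| ^+ 2
      = enorm (adjoint K x) ^+ 2].

Lemma dotC u v : dot u v = dot v u.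
Proof. by apply: eq_bigr => i _; rewrite mulrC. Qed.

Lemma dotDr u v w : dot u (v + w) = dot u v + dot u w.
Proof. by rewrite -big_split; apply: eq_bigr => i _; rewrite mxE mulrDr. Qed.

Lemma dotZr c u v : dot u (c *: v) = c * dot u v.
Proof. by rewrite big_distrr; apply: eq_bigr => i _; rewrite mxE mulrCA. Qed.

Lemma dot_sumr u (I : finType) (F : I -> V) :
  dot u (\sum_i F i) = \sum_i dot u (F i).
Proof.
apply: (big_morph (dot u) (dotDr u)).
by rewrite -[0](scale0r 0) dotZr mul0r.
Qed.

Lemma adjoint_is_linear (K : 'End(V)) :
  linear (adjoint_fun K).
Proof. by move=> c u v; apply/colP => i; rewrite !mxE dotDr dotZr. Qed.

HB.instance Definition _ (K : 'End(V)) :=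
  GRing.isLinear.Build R V V _ (adjoint_fun K) (adjoint_is_linear K).

Lemma dot_adjoint (K : 'End(V)) u v : dot (K u) v = dot u (adjoint K v).
Proof.
have Ku : K u = \sum_i u i 0 *: K (delta_mx i 0).
  rewrite {1}[u]matrix_sum_delta linear_sum; apply: eq_bigr => i _.
  by rewrite big_ord1 linearZ /=.
rewrite dotC Ku dot_sumr; apply: eq_bigr => i _.
by rewrite dotZr lfunE !mxE dotC.
Qed.

Lemma dot_delta i v : dot (delta_mx i 0) v = v i 0.
Proof.
rewrite /dot (bigD1 i) //= mxE !eqxx mul1r big1 ?addr0 // => j /negPf ji.
by rewrite mxE ji mul0r.
Qed.

Lemma dot_ext (v w : V) : (forall u, dot u v = dot u w) -> v = w.
Proof.
by move=> vw; apply/colP => i; have := vw (delta_mx i 0); rewrite !dot_delta.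
Qed.

Lemma lfun_stable_limg (K P : 'End(V)) x :
  (K \o P)%VF = (P \o K)%VF -> x \in limg P -> K x \in limg P.
Proof.
move=> KP /memv_imgP[y _ ->].
by rewrite -comp_lfunE KP comp_lfunE memv_img ?memvf.
Qed.

Lemma adjoint_stable_limg (K P : 'End(V)) x :
  orthogonal_projection P -> (K \o P)%VF = (P \o K)%VF ->
  x \in limg P -> adjoint K x \in limg P.
Proof.
move=> [_ adjP] KP; apply: lfun_stable_limg; apply/lfunP => y.
have dotP u v : dot (P u) v = dot u (P v) by rewrite dot_adjoint adjP.
rewrite !comp_lfunE; apply: dot_ext => u.
rewrite -dot_adjoint -!dotP -dot_adjoint.
by rewrite -!comp_lfunE KP.
Qed.

End EuclideanSpace.

(* Main.v *)
(* Put Q = I - P. The ranges X and Y of P and Q are orthogonal and stable under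
   K^*, so for every x, |K^* x|^2 = |K^* P x|^2 + |K^* Q x|^2, while
     sum_j |<x, a_j P f_j + b_j Q f_j>|^2
       = sum_j |<P x, a_j P f_j>|^2 + sum_j |<Q x, b_j Q f_j>|^2
         + 2 sum_j a_j b_j <x, P f_j> <x, Q f_j>.
   Restricting the K_s^p identity to X and to Y gives the two Parseval
   identities; given those, the K_s^p identity at x says exactly that the cross
   term vanishes. *)

Require Import Defs.
From mathcomp Require Import all_boot all_order all_algebra.
From mathcomp Require Import reals ring.

Set Implicit Arguments.
Unset Strict Implicit.
Unset Printing Implicit Defensive.

Import Order.TTheory GRing.Theory Num.Theory.
Local Open Scope ring_scope.

Section OrthogonalProjections.
Variables (R : realType) (n : nat).
Local Notation V := 'cV[R]_n.
Implicit Types (K P : 'End(V)) (x y u v : V).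

Lemma dotDl u v x : dot (u + v) x = dot u x + dot v x.
Proof. by rewrite ![dot _ x]dotC dotDr. Qed.

Lemma dot_ge0 u : 0 <= dot u u.
Proof. by apply: sumr_ge0 => i _; rewrite -expr2 sqr_ge0. Qed.

Lemma enorm_sqr u : enorm u ^+ 2 = dot u u.
Proof. by rewrite sqr_sqrtr ?dot_ge0. Qed.

Lemma enorm_sqrD u v : dot u v = 0 ->
  enorm (u + v) ^+ 2 = enorm u ^+ 2 + enorm v ^+ 2.
Proof.
move=> uv0.
by rewrite !enorm_sqr dotDl !dotDr [dot v u]dotC uv0 addr0 add0r.
Qed.

Lemma projection_id P x : orthogonal_projection P -> x \in limg P -> P x = x.
Proof. by move=> [PP _] /memv_imgP[y _ ->]; rewrite -comp_lfunE PP. Qed.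

Lemma dot_projection P u v : orthogonal_projection P ->
  dot (P u) v = dot u (P v).
Proof. by move=> [_ adjP]; rewrite dot_adjoint adjP. Qed.

Lemma projection_split P x : x = P x + (\1 - P)%VF x.
Proof. by rewrite add_lfunE opp_lfunE id_lfunE addrC subrK. Qed.

Lemma orthogonal_projection_compl P :
  orthogonal_projection P -> orthogonal_projection (\1 - P)%VF.
Proof.
move=> hP; have [PP _] := hP; split.
  rewrite comp_lfunDl comp_lfun1l comp_lfunNl comp_lfunDr comp_lfun1r.
  by rewrite comp_lfunNr PP subrr oppr0 addr0.
apply/lfunP => v; apply: dot_ext => u; rewrite -dot_adjoint.
(* Negatives are turned into scalings by -1, so that [dotZr] applies to them. *)
rewrite !add_lfunE !opp_lfunE !id_lfunE dotDl dotDr -!scaleN1r dotZr.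
by rewrite [dot (_ *: _) v]dotC dotZr [dot v _]dotC dot_projection.
Qed.

Lemma comp_lfun_compl K P : (K \o P)%VF = (P \o K)%VF ->
  (K \o (\1 - P))%VF = ((\1 - P) \o K)%VF.
Proof.
by move=> KP; rewrite comp_lfunDl comp_lfunDr comp_lfunNl comp_lfunNr
  comp_lfun1l comp_lfun1r KP.
Qed.

(** Self-adjointness moves [P] from [x = P x] onto [y = (I - P) y], where P (I - P) = P - P^2 =
    0. *)
Lemma dot_limg_compl P x y : orthogonal_projection P ->
  x \in limg P -> y \in limg (\1 - P)%VF -> dot x y = 0.
Proof.
move=> hP xP yQ; rewrite -(projection_id hP xP) dot_projection //.
rewrite -(projection_id (orthogonal_projection_compl hP) yQ).
rewrite add_lfunE opp_lfunE id_lfunE linearB /= -[P (P y)]comp_lfunE.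
by have [-> _] := hP; rewrite subrr -[0](scale0r 0) dotZr mul0r.
Qed.

(** Pythagoras: K commutes with P, hence also with I - P, so K^* keeps each of the two orthogonal
    ranges stable. *)
Lemma enorm_adjoint_split K P x :
  orthogonal_projection P -> (K \o P)%VF = (P \o K)%VF ->
  enorm (adjoint K x) ^+ 2 =
  enorm (adjoint K (P x)) ^+ 2 + enorm (adjoint K ((\1 - P)%VF x)) ^+ 2.
Proof.
move=> hP hKP; rewrite {1}(projection_split P x) linearD /= enorm_sqrD //.
apply: (dot_limg_compl hP); apply: adjoint_stable_limg; rewrite ?memv_img ?memvf //.
  exact: orthogonal_projection_compl.
exact: comp_lfun_compl.
Qed.

(** The bounds of [f] serve again, since <x, P f_j> = <P x, f_j> = <x, f_j> for x in the range of
    P. *)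
Lemma K_frame_projection K P m (f : 'I_m -> V) : orthogonal_projection P ->
  K_frame K fullv f -> K_frame K (limg P) (fun j => P (f j)).
Proof.
move=> hP [_ [A [B [A0 B0 hAB]]]]; split=> [j|]; first by rewrite memv_img ?memvf.
exists A, B; split=> // x xP.
under eq_bigr do rewrite -dot_projection // (projection_id hP xP).
exact: hAB (memvf x).
Qed.

Lemma dot_piecewise_limg P x u v c d : orthogonal_projection P ->
  x \in limg P ->
  dot x (c *: P u + d *: (\1 - P)%VF v) = dot x (c *: P u).
Proof.
move=> hP xP; have xQv := dot_limg_compl hP xP (memv_img _ (memvf v)).
by rewrite dotDr [dot x (d *: _)]dotZr xQv mulr0 addr0.
Qed.

Lemma dot_piecewise_limg_compl P x u v c d : orthogonal_projection P ->
  x \in limg (\1 - P)%VF ->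
  dot x (c *: P u + d *: (\1 - P)%VF v) = dot x (d *: (\1 - P)%VF v).
Proof.
move=> hP xQ; have Pux := dot_limg_compl hP (memv_img _ (memvf u)) xQ.
by rewrite dotDr dotZr dotC Pux mulr0 add0r.
Qed.

(** Termwise this is (s + t)^2 = s^2 + t^2 + 2 s t, because <P x, P f_j> = <x, P f_j>, and likewise
    for I - P. *)
Lemma sum_piecewise P m (f : 'I_m -> V) (a b : 'I_m -> R) x :
  orthogonal_projection P ->
  \sum_(j < m) `|dot x (a j *: P (f j) + b j *: (\1 - P)%VF (f j))| ^+ 2 =
  \sum_(j < m) `|dot (P x) (a j *: P (f j))| ^+ 2 +
  \sum_(j < m) `|dot ((\1 - P)%VF x) (b j *: (\1 - P)%VF (f j))| ^+ 2 +
  (\sum_(j < m) a j * b j * dot x (P (f j)) * dot x ((\1 - P)%VF (f j))) *+ 2.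
Proof.
move=> hP; have hQ := orthogonal_projection_compl hP.
rewrite -sumrMnl -!big_split; apply: eq_bigr => j _ /=.
rewrite !real_normK ?num_real // !dotDr !dotZr.
rewrite (dot_projection _ _ hP) (dot_projection _ _ hQ).
rewrite (projection_id hP (memv_img _ (memvf _))).
rewrite (projection_id hQ (memv_img _ (memvf _))).
ring.
Qed.

End OrthogonalProjections.

Theorem theorem4p2 (R : realType) (n : nat) (K : 'End('cV[R]_n))
    (f : 'I_n -> 'cV[R]_n) (P : 'End('cV[R]_n)) (a b : 'I_n -> R)
    (hf : K_frame K fullv f) (hP : orthogonal_projection P)
    (hKP : (K \o P)%VF = (P \o K)%VF) :
  Ksp_frame K f P a b <->
  (Ks_frame K (limg P) (fun j => P (f j)) a /\
   Ks_frame K (limg (\1 - P)%VF) (fun j => (\1 - P)%VF (f j)) b) /\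
  (forall x : 'cV[R]_n,
     \sum_(j < n) a j * b j * dot x (P (f j)) * dot x ((\1 - P)%VF (f j)) = 0).
Proof.
have hQ := orthogonal_projection_compl hP.
(* The converse comes first: the Parseval identities are applied at P x and (I - P) x. *)
split=> [[_ _ hfP]|[[[_ [_ hX]] [_ [_ hY]]] h0]]; last first.
  split=> // x; rewrite sum_piecewise // h0 mul0rn addr0.
  by rewrite (enorm_adjoint_split x hP hKP) hX ?hY ?memv_img ?memvf.
have hX x : x \in limg P ->
    \sum_(j < n) `|dot x (a j *: P (f j))| ^+ 2 = enorm (adjoint K x) ^+ 2.
  move=> xP; rewrite -hfP; apply: eq_bigr => j _.
  by rewrite dot_piecewise_limg.
have hY x : x \in limg (\1 - P)%VF ->
    \sum_(j < n) `|dot x (b j *: (\1 - P)%VF (f j))| ^+ 2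
    = enorm (adjoint K x) ^+ 2.
  move=> xQ; rewrite -hfP; apply: eq_bigr => j _.
  by rewrite dot_piecewise_limg_compl.
split; first split.
(* The frame bounds come from [hf]; only the Parseval identity uses [hfP]. *)
- split; first exact: K_frame_projection.
  by split=> // j; rewrite memvZ ?memv_img ?memvf.
- split; first exact: K_frame_projection.
  by split=> // j; rewrite memvZ ?memv_img ?memvf.
- move=> x; have := hfP x; rewrite sum_piecewise // (enorm_adjoint_split x hP hKP).
  (* Both sides now share the same two squared norms; cancelling them leaves twice the cross term
     equal to 0, in characteristic zero. *)
  rewrite hX ?hY ?memv_img ?memvf // => /eqP.
  by rewrite -subr_eq0 addrAC subrr add0r mulrn_eq0 /= => /eqP.
Qed.
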